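(* For all $m\ge1$ and $p\ge0$: (1) $L(E_{m,1},p+1)=p\cdot2^m-N_1(b,p)\cdot2^{m-1}+1$; (2) $L(E_{m,2},p+1)=(3p+2)\cdot2^{m-1}-N_2(a,p)\cdot2^m+N_2(b,p)\cdot2^{m+1}+1$.
   Context: Let $\sigma$ be the morphism on $\{a,b\}^*$ with $\sigma(a)=ab$, $\sigma(b)=aa$. The Doubling sequence is $D_\infty=x_1x_2x_3\cdots=\sigma^\infty(a)=abaaabab\cdots$, the infinite fixed point of $\sigma$ beginning with $a$. Put $A_m=\sigma^m(a)$ for $m\ge0$ and let $\delta_m$ be the last letter of $A_m$. For $m\ge1$ set $E_{m,1}=A_m\delta_m^{-1}$ (i.e. $A_m$ with its last letter removed) and $E_{m,2}=A_{m-1}A_m\delta_m^{-1}$. For a factor $\omega$ of $D_\infty$, $L(\omega,p)$ is the position in $D_\infty$ (index of the first letter) of the $p$-th occurrence of $\omega$, $p\ge1$, occurrences (overlaps allowed) being ordered by starting position. Let $\varphi_1(a)=a$, $\varphi_1(b)=bb$ and $\varphi_2(a)=ab$, $\varphi_2(b)=acac$, extended to infinite words by concatenation; $\Theta_1=\varphi_1(D_\infty)$ and $\Theta_2=\varphi_2(D_\infty)$. For $p\ge0$, $N_j(x,p)$ is the number of occurrences of the letter $x$ among the first $p$ letters of $\Theta_j$. *)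

(* Defs.v *)
From HB Require Import structures.
From mathcomp Require Import all_boot.
From mathcomp Require Import zify.

Set Implicit Arguments.
Unset Strict Implicit.
Unset Printing Implicit Defensive.

Variant ab := a | b.
Variant abc := a3 | b3 | c3.

Definition ab_code (x : ab) : bool := if x is a then true else false.
Definition ab_decode (c : bool) : ab := if c then a else b.
Lemma ab_codeK : cancel ab_code ab_decode. Proof. by case. Qed.
HB.instance Definition _ := Equality.copy ab (can_type ab_codeK).

Definition abc_code (x : abc) : option bool :=
  match x with a3 => None | b3 => Some true | c3 => Some false end.
Definition abc_decode (c : option bool) : abc :=
  match c with None => a3 | Some true => b3 | Some false => c3 end.
Lemma abc_codeK : cancel abc_code abc_decode. Proof. by case. Qed.
HB.instance Definition _ := Equality.copy abc (can_type abc_codeK).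

(* A morphism of free monoids is given by the images of the letters. *)
Definition morph (S T : Type) (f : S -> seq T) (w : seq S) : seq T :=
  flatten (map f w).

(* Infinite words are functions [nat -> T]; the letter written x_i in the
   mathematics (i >= 1) is [x i.-1]. *)
Definition prefix_of (T : Type) (x : nat -> T) (n : nat) : seq T := mkseq x n.

(* Image of an infinite word under a non-erasing morphism: the images of the
   first n+1 letters already contain at least n+1 letters, so that the default
   value [y0] is never used. *)
Definition morph_inf (S T : Type) (y0 : T) (f : S -> seq T) (x : nat -> S) :
    nat -> T :=
  fun n => nth y0 (morph f (prefix_of x n.+1)) n.

Definition sigma (x : ab) : seq ab :=
  match x with a => [:: a; b] | b => [:: a; a] end.

Definition A (m : nat) : seq ab := iter m (morph sigma) [:: a].

(* Since A_n is a prefix of A_{n+1} and |A_n| = 2^n > n, this is the limit of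
   the words A_n; see [D_fixed] and [D_unique]. *)
Definition D (n : nat) : ab := nth a (A n) n.

Definition delta (m : nat) : ab := last a (A m).

Definition E1 (m : nat) : seq ab := take (size (A m)).-1 (A m).
Definition E2 (m : nat) : seq ab := A m.-1 ++ E1 m.

Definition phi1 (x : ab) : seq ab :=
  match x with a => [:: a] | b => [:: b; b] end.
Definition phi2 (x : ab) : seq abc :=
  match x with a => [:: a3; b3] | b => [:: a3; c3; a3; c3] end.

Definition Theta1 : nat -> ab := morph_inf a phi1 D.
Definition Theta2 : nat -> abc := morph_inf a3 phi2 D.

Definition N1 (x : ab) (p : nat) : nat := count_mem x (prefix_of Theta1 p).
Definition N2 (x : abc) (p : nat) : nat := count_mem x (prefix_of Theta2 p).

(* [w] occurs in [x] with its first letter at the (1-based) position [i]. *)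
Definition occurs_at (T : eqType) (x : nat -> T) (w : seq T) (i : nat) : bool :=
  (0 < i) && (mkseq (fun k => x (i.-1 + k)) (size w) == w).

(* The graph of the partial function L, i.e. L(w, p) = n: the word [w] occurs
   in D at position n, and exactly p of its occurrences start at a position
   in {1, ..., n} (itself included). *)
Definition is_L (w : seq ab) (p n : nat) : Prop :=
  occurs_at D w n /\ count (occurs_at D w) (iota 1 n) = p.

Lemma is_L_fun w p n n' : is_L w p n -> is_L w p n' -> n = n'.
Proof.
wlog le_nn' : n n' / n <= n' => [H h h'|].
  by case/orP: (leq_total n n') => ?; [exact: H|apply/esym/H].
move=> [_ hn] [on' hn']; apply/eqP; rewrite eqn_leq le_nn' leqNgt.
apply/negP => lt_nn'.
have : has (occurs_at D w) (iota (1 + n) (n' - n)).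
  by apply/hasP; exists n' => //; rewrite mem_iota; lia.
rewrite has_count.
by move: hn'; rewrite -{1}(subnKC le_nn') iotaD count_cat hn; lia.
Qed.

Lemma size_morph_sigma w : size (morph sigma w) = 2 * size w.
Proof.
elim: w => //= x w IH.
by rewrite /morph /= size_cat -/(morph sigma w) IH mulnS; case: x.
Qed.

Lemma AS m : A m.+1 = morph sigma (A m).
Proof. by []. Qed.

Lemma size_A m : size (A m) = 2 ^ m.
Proof. by elim: m => // m IH; rewrite AS size_morph_sigma IH expnS. Qed.

Lemma E1_delta m : rcons (E1 m) (delta m) = A m.
Proof.
rewrite /E1 /delta; have : 0 < size (A m) by rewrite size_A expn_gt0.
case/lastP: (A m) => // s x _.
by rewrite size_rcons /= last_rcons -[in take _ _]cats1 take_size_cat.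
Qed.

Lemma A_prefix m : exists v, A m.+1 = A m ++ v.
Proof.
elim: m => [|m [v IH]]; first by exists [:: b].
by exists (morph sigma v); rewrite AS {1}IH /morph map_cat flatten_cat.
Qed.

Lemma nth_A m n : n < 2 ^ m -> nth a (A m) n = D n.
Proof.
have mono k l i : i < 2 ^ k -> nth a (A (k + l)) i = nth a (A k) i.
  move=> ltik; elim: l => [|l IH]; first by rewrite addn0.
  have [v Ev] := A_prefix (k + l).
  rewrite addnS Ev nth_cat size_A (leq_trans ltik) ?IH //.
  by rewrite leq_exp2l ?leq_addr.
move=> lt; rewrite /D; case/orP: (leq_total m n) => h.
  by rewrite -{2}(subnKC h) mono.
by rewrite -{1}(subnKC h) mono // ltn_expl.
Qed.

Lemma nth_morph_sigma w n : n < 2 * size w ->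
  nth a (morph sigma w) n = nth a (sigma (nth a w n./2)) (odd n).
Proof.
elim: w n => [|x w IH] n; first by rewrite muln0.
have -> : morph sigma (x :: w) = sigma x ++ morph sigma w by [].
case: n => [|[|n]] /=; try by case: x.
rewrite mulnS negbK => lt; rewrite -IH; last by lia.
by case: x.
Qed.

Lemma morph_inf_sigma x n :
  morph_inf a sigma x n = nth a (sigma (x n./2)) (odd n).
Proof.
by rewrite /morph_inf nth_morph_sigma ?size_mkseq ?nth_mkseq //; lia.
Qed.

Lemma D_start : D 0 = a.
Proof. by []. Qed.

Lemma D_fixed : morph_inf a sigma D =1 D.
Proof.
move=> n; rewrite morph_inf_sigma.
have ltn2 : n < 2 ^ n by rewrite ltn_expl.
rewrite -(@nth_A n.+1 n); last by rewrite expnS; lia.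
rewrite AS nth_morph_sigma ?size_A; last by lia.
by rewrite nth_A //; lia.
Qed.

Lemma D_unique x : x 0 = a -> morph_inf a sigma x =1 x -> x =1 D.
Proof.
move=> x0 xs n; elim/ltn_ind: n => -[//|n] IH.
by rewrite -xs -D_fixed !morph_inf_sigma IH //; lia.
Qed.

(* Main.v *)
(** Every odd-indexed letter of [D] (counting from 0) is the complement of a
    letter of [D] and every even-indexed letter is [a].  Hence a word
    [sigma(w) a] with [w] beginning with [a] occurs exactly at the doubles of
    the occurrences of [w]; as [E_{m+1,j} = sigma(E_{m,j}) a], this reduces
    everything to the words [E_{1,1} = a] and [E_{1,2} = aa].

    For these, cut [D] into the blocks [sigma(x)], resp. [sigma^3(x)], with [x]
    running through the letters of [D].  The gaps between consecutive
    occurrences of [a] are spelled out by [phi1 x] on the block [sigma(x)], with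
    gaps 2, 1 coded by a, b; those of [aa] are spelled out by [phi2 x] on the
    block [sigma^3(x)], with gaps 1, 7, 3 coded by a, b, c.  So a position is a
    sum of gaps along a prefix of [Theta_j]. *)

Require Import Defs.
From mathcomp Require Import all_boot all_order all_algebra.
From mathcomp Require Import zify.
Import GRing.Theory Num.Theory.

Set Implicit Arguments.
Unset Strict Implicit.
Unset Printing Implicit Defensive.

(** * Counting along a strictly increasing enumeration *)

Lemma count_range (P : pred nat) (f : nat -> nat) :
    (forall p, f p < f p.+1) -> (forall i, P i <-> exists p, i = f p) ->
  forall p, count P (iota 0 (f p).+1) = p.+1.
Proof.
move=> incr rangeP.
have mono : {mono f : m n / m < n}.
  apply: leqW_mono; apply: leq_mono.
  by apply: homo_ltn => //; exact: ltn_trans.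
have gap0 s n : (forall i, s <= i < s + n -> ~ P i) -> count P (iota s n) = 0.
  move=> H; apply/eqP; rewrite -leqn0 leqNgt -has_count; apply/hasPn => i.
  by rewrite mem_iota => /H/negP.
have Pf p : P (f p) by apply/rangeP; exists p.
elim=> [|p IH].
  rewrite -addn1 iotaD count_cat gap0 /= ?add0n ?Pf // => i lti /rangeP[q qE].
  have : f q < f 0 by lia.
  by rewrite mono.
have -> : (f p.+1).+1 = (f p).+1 + (f p.+1 - (f p).+1 + 1).
  by have := incr p; lia.
(* Strictly between [f p] and [f p.+1] there is no value of [f], as no index lies strictly between
   [p] and [p.+1]. *)
rewrite iotaD count_cat IH iotaD count_cat add0n gap0 /=; last first.
  move=> i lti /rangeP[q qE].
  have : f p < f q by lia.
  have : f q < f p.+1 by have := incr p; lia.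
  by rewrite !mono; lia.
have -> : (f p).+1 + (f p.+1 - (f p).+1) = f p.+1 by have := incr p; lia.
by rewrite Pf addn1.
Qed.

(** * Positions as sums of gaps along the image of a word *)

Section GapCoding.

Variables (S T : Type) (y0 : T) (phi : S -> seq T) (x : nat -> S).
Hypothesis phi_gt0 : forall s, 0 < size (phi s).

Let Theta := morph_inf y0 phi x.
Let W n := morph phi (prefix_of x n).

Lemma morph_prefixS n : W n.+1 = W n ++ phi (x n).
Proof.
by rewrite /W /morph /prefix_of mkseqS map_rcons flatten_rcons.
Qed.

Lemma leq_size_morph_prefix n : n <= size (W n).
Proof.
elim: n => // n IH; rewrite morph_prefixS size_cat.
by have := phi_gt0 (x n); lia.
Qed.

(** The words [W n] extend one another, so any of them long enough gives the same letter; [W i.+1]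
    is, since [phi] is non-erasing. *)
Lemma nth_morph_prefix n i : i < size (W n) -> nth y0 (W n) i = Theta i.
Proof.
have mono k l : i < size (W k) -> nth y0 (W (k + l)) i = nth y0 (W k) i.
  move=> lti; elim: l => [|l IH]; first by rewrite addn0.
  rewrite addnS morph_prefixS nth_cat IH ifT //.
  apply: leq_trans lti _; elim: l {IH} => [|l IH]; first by rewrite addn0.
  by rewrite addnS morph_prefixS size_cat; lia.
move=> lti; rewrite /Theta /morph_inf -/(W i.+1).
have lti' := leq_size_morph_prefix i.+1.
by case/orP: (leq_total n i.+1) => h; rewrite -(subnKC h) mono.
Qed.

Lemma prefix_morph_inf n r : r <= size (phi (x n)) ->
  prefix_of Theta (size (W n) + r) = W n ++ take r (phi (x n)).
Proof.
move=> ler; apply: (@eq_from_nth _ y0).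
  by rewrite size_mkseq size_cat size_takel.
move=> i; rewrite size_mkseq => lti; rewrite nth_mkseq //.
rewrite -(@nth_morph_prefix n.+1); last by rewrite morph_prefixS size_cat; lia.
rewrite morph_prefixS !nth_cat; case: ifP => // /negbT geqi.
by rewrite nth_take //; lia.
Qed.

Lemma morph_prefix_split p :
  exists n r, r < size (phi (x n)) /\ p = size (W n) + r.
Proof.
elim: p => [|p [n [r [ltr ->]]]]; first by exists 0, 0.
have [ltr1|] := ltnP r.+1 (size (phi (x n))); first by exists n, r.+1; lia.
by exists n.+1, 0; rewrite morph_prefixS size_cat; split=> //; lia.
Qed.

Variables (P : pred nat) (g : T -> nat) (c l : nat).
Hypothesis l_gt0 : 0 < l.
Hypothesis gap_block : forall s, sumn (map g (phi s)) = l.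

(** The 0-based position of occurrence number [p.+1]: [c] is the first position and [g] turns a
    letter into a gap. *)
Definition gap_sum p := c + sumn (map g (prefix_of Theta p)).

Lemma gap_sumS p : gap_sum p.+1 = gap_sum p + g (Theta p).
Proof. by rewrite /gap_sum /prefix_of mkseqS map_rcons sumn_rcons addnA. Qed.

Lemma gap_sum_block n r : r <= size (phi (x n)) ->
  gap_sum (size (W n) + r) = l * n + (c + sumn (map g (take r (phi (x n))))).
Proof.
move=> ler; rewrite /gap_sum prefix_morph_inf // map_cat sumn_cat.
suff -> : sumn (map g (W n)) = l * n by lia.
elim: n {ler} => [|n IH]; first by rewrite muln0.
by rewrite morph_prefixS map_cat sumn_cat IH gap_block; lia.
Qed.

(** An index splits as [size (W n) + r] and a position as [l * n + j] with [j < l]. As the gaps of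
    every block add up to [l], both splittings share the same [n], so one block at a time
    suffices. *)
Lemma gap_sum_range :
    (forall s r, r < size (phi s) -> c + sumn (map g (take r (phi s))) < l) ->
    (forall n j, j < l -> P (l * n + j) =
       (j \in [seq c + sumn (map g (take r (phi (x n))))
              | r <- iota 0 (size (phi (x n)))])) ->
  forall i, P i <-> exists p, i = gap_sum p.
Proof.
move=> offset_lt blockP i; split.
  rewrite (divn_eq i l) mulnC blockP ?ltn_mod // => /mapP[r].
  rewrite mem_iota => ltr ->; exists (size (W (i %/ l)) + r).
  by rewrite gap_sum_block //; lia.
case=> p ->; have [n [r [ltr ->]]] := morph_prefix_split p.
rewrite gap_sum_block; last by lia.
rewrite blockP ?offset_lt //; apply/mapP; exists r => //.
by rewrite mem_iota.
Qed.

End GapCoding.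

(** * Parity structure of [D] and lifting of occurrences *)

Lemma D_sigma n : D n = nth a (sigma (D n./2)) (odd n).
Proof. by rewrite -[LHS]D_fixed morph_inf_sigma. Qed.

Definition flip (x : ab) : ab := if x is a then b else a.

Lemma D_double n : D n.*2 = a.
Proof. by rewrite D_sigma odd_double doubleK; case: (D n). Qed.

Lemma D_doubleS n : D n.*2.+1 = flip (D n).
Proof. by rewrite D_sigma /= odd_double uphalf_double; case: (D n). Qed.

(** Positions start at 0 here, so that lifting a word doubles its positions with no offset. *)
Definition occurs0 (w : seq ab) (i : nat) : bool :=
  mkseq (fun k => D (i + k)) (size w) == w.

Lemma occurs0P w i :
  reflect (forall k, k < size w -> D (i + k) = nth a w k) (occurs0 w i).
Proof.
apply: (iffP eqP) => [Ew k ltk|H].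
  by rewrite -[in RHS]Ew nth_mkseq.
apply: (@eq_from_nth _ a); rewrite size_mkseq // => k ltk.
by rewrite nth_mkseq ?H.
Qed.

Definition lift (w : seq ab) : seq ab := rcons (morph sigma w) a.

Lemma occurs_lift w i :
  0 < size w -> nth a w 0 = a ->
  occurs0 (lift w) i = ~~ odd i && occurs0 w i./2.
Proof.
move=> w_gt0 w0; have size_lift : size (lift w) = (2 * size w).+1.
  by rewrite size_rcons size_morph_sigma.
have nth_lift k : k < 2 * size w ->
    nth a (lift w) k = nth a (sigma (nth a w k./2)) (odd k).
  by move=> ltk; rewrite nth_rcons size_morph_sigma ltk nth_morph_sigma.
apply/occurs0P/andP => [H|[/negbTE i_even /occurs0P H] k].
  (* The second letter of [lift w] is [b], the last letter of [sigma a], whereas even positions of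
     [D] carry only [a]. *)
  have i_even : ~~ odd i.
    apply/negP => i_odd; have lt1 : 1 < size (lift w) by rewrite size_lift; lia.
    have := H 1 lt1; rewrite nth_lift; last by lia.
    have -> : i + 1 = (i./2.+1).*2 by lia.
    by rewrite D_double /= w0.
  split=> //; apply/occurs0P => k ltk.
  (* The second letter of [sigma x] determines [x], so the odd letters recover [w]. *)
  have ltk2 : k.*2.+1 < size (lift w) by rewrite size_lift; lia.
  have := H _ ltk2; rewrite nth_lift; last by lia.
  have -> : i + k.*2.+1 = (i./2 + k).*2.+1 by lia.
  rewrite D_doubleS /= odd_double uphalf_double.
  by case: (D _); case: (nth a w k).
rewrite size_lift ltnS leq_eqVlt => /orP[/eqP->|ltk].
  have -> : i + 2 * size w = (i./2 + size w).*2 by lia.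
  by rewrite D_double nth_rcons size_morph_sigma ltnn eqxx.
rewrite nth_lift // D_sigma oddD i_even /= halfD i_even add0n H //; lia.
Qed.

Lemma occurs_iter_lift w (f : nat -> nat) m :
    0 < size w -> nth a w 0 = a ->
    (forall i, occurs0 w i <-> exists p, i = f p) ->
  forall i, occurs0 (iter m lift w) i <-> exists p, i = 2 ^ m * f p.
Proof.
move=> w_gt0 w0 wP.
have start k : 0 < size (iter k lift w) /\ nth a (iter k lift w) 0 = a.
  elim: k => // k [u_gt0 u0]; rewrite iterS /lift size_rcons; split=> //.
  rewrite nth_rcons size_morph_sigma muln_gt0 u_gt0.
  by rewrite nth_morph_sigma /= ?u0 // muln_gt0.
elim: m => [|m IH] i.
  by rewrite wP; split=> -[p ->]; exists p; rewrite mul1n.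
have [u_gt0 u0] := start m; rewrite iterS occurs_lift //; split.
  move=> /andP[i_even /IH[p ip]]; exists p; rewrite expnS -mulnA -ip; lia.
case=> p ->; rewrite expnS -mulnA mul2n odd_double doubleK /=.
by apply/IH; exists p.
Qed.

Lemma is_L_range w (f : nat -> nat) :
    (forall p, f p < f p.+1) -> (forall i, occurs0 w i <-> exists p, i = f p) ->
  forall p, is_L w p.+1 (f p).+1.
Proof.
move=> incr wP p; split.
  by rewrite /occurs_at /= -/(occurs0 w (f p)); apply/wP; exists p.
(* Shifting the range by one passes from 1-based to 0-based positions. *)
rewrite -[RHS](count_range incr wP) -[1]/(1 + 0) iotaDl count_map.
exact: eq_count.
Qed.

(** Both values of [sigma] start with [a], so removing the last letter of [A m.+1] leaves the image
    of [E1 m] followed by [a]. *)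
Lemma E1S m : E1 m.+1 = lift (E1 m).
Proof.
have := E1_delta m.+1; rewrite AS -(E1_delta m) /morph map_rcons flatten_rcons.
rewrite -/(morph sigma (E1 m)); set y := nth a (sigma (delta m)) 1.
have -> : sigma (delta m) = rcons [:: a] y by rewrite /y; case: (delta m).
by rewrite -rcons_cat cats1 => /rcons_inj[].
Qed.

Lemma E1_iter m : E1 m.+1 = iter m lift [:: a].
Proof. by elim: m => // m IH; rewrite E1S IH. Qed.

Lemma E2_iter m : E2 m.+1 = iter m lift [:: a; a].
Proof.
elim: m => // m IH; rewrite iterS -IH /E2 /= E1S /lift /morph map_cat.
by rewrite flatten_cat rcons_cat.
Qed.

(** * The base words and the closed formulas *)

Definition gap1 (x : ab) : nat := if x is a then 2 else 1.
Definition gap2 (x : abc) : nat :=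
  match x with a3 => 1 | b3 => 7 | c3 => 3 end.

Lemma occurs_a i : occurs0 [:: a] i <-> exists p, i = gap_sum a phi1 D gap1 0 p.
Proof.
apply: (@gap_sum_range _ _ _ _ _ _ _ _ _ 2) => //; try by case.
- by case=> -[|[]].
- move=> n j ltj; rewrite /occurs0 /mkseq /= mul2n.
  case: j ltj => [|[|//]] _; rewrite ?addn1 !addn0 ?D_double ?D_doubleS.
  all: by case: (D n).
Qed.

Lemma occurs_aa i :
  occurs0 [:: a; a] i <-> exists p, i = gap_sum a3 phi2 D gap2 2 p.
Proof.
apply: (@gap_sum_range _ _ _ _ _ _ _ _ _ 8) => //; try by case.
- by case=> -[|[|[|[]]]].
- move=> n j ltj; rewrite /occurs0 /mkseq /= addn0 addn1.
  (* Iterated doubling expresses each letter through [D n]. At offset 7 the second letter opens the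
     next block and is always [a]. *)
  have -> : 8 * n = n.*2.*2.*2 by lia.
  do 8?[case: j ltj => [|j] ltj]; last by lia.
  all: rewrite ?addnS ?addn0 -?doubleS ?D_double ?D_doubleS -?doubleS.
  all: rewrite ?D_double ?D_doubleS -?doubleS ?D_double ?D_doubleS.
  all: by case: (D n).
Qed.

Lemma gap_sum1E p : gap_sum a phi1 D gap1 0 p + N1 b p = 2 * p.
Proof.
rewrite /gap_sum /N1 -/Theta1 -{3}(size_mkseq Theta1 p).
rewrite -/(prefix_of Theta1 p).
by elim: (prefix_of _ _) => //= -[] s /=; lia.
Qed.

(** The gaps 1, 7, 3 are 3 - 2, 3 + 4 and 3; the negative term is moved across to stay in [nat]. *)
Lemma gap_sum2E p :
  gap_sum a3 phi2 D gap2 2 p + 2 * N2 a3 p = 3 * p + 2 + 4 * N2 b3 p.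
Proof.
rewrite /gap_sum /N2 -/Theta2 -{3}(size_mkseq Theta2 p).
rewrite -/(prefix_of Theta2 p).
by elim: (prefix_of _ _) => //= -[] s /=; lia.
Qed.

Local Open Scope ring_scope.

Theorem proposition6p2 (m p : nat) (hm : (1 <= m)%N) :
  (exists n : nat, is_L (E1 m) p.+1 n /\
     n%:Z = p%:Z * 2 ^+ m - (N1 b p)%:Z * 2 ^+ m.-1 + 1) /\
  (exists n : nat, is_L (E2 m) p.+1 n /\
     n%:Z = (3 * p%:Z + 2) * 2 ^+ m.-1 - (N2 a3 p)%:Z * 2 ^+ m
            + (N2 b3 p)%:Z * 2 ^+ m.+1 + 1).
Proof.
case: m hm => // m _; rewrite succnK E1_iter E2_iter.
have pow2 : (2 : int) ^+ m = (2 ^ m)%N%:Z by rewrite -natrX natz.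
split.
  exists (2 ^ m * gap_sum a phi1 D gap1 0 p)%N.+1; split.
    apply: (@is_L_range _ (fun p => 2 ^ m * gap_sum a phi1 D gap1 0 p)%N).
      move=> q; rewrite ltn_pmul2l ?expn_gt0 // gap_sumS.
      by case: (morph_inf _ _ _ _) => /=; lia.
    by apply: occurs_iter_lift => //; exact: occurs_a.
  (* Here [m] stands for the original exponent minus one; the formula is [gap_sum1E] times [2 ^ m],
     plus one for 1-based positions. *)
  by rewrite exprS pow2; have := gap_sum1E p; nia.
exists (2 ^ m * gap_sum a3 phi2 D gap2 2 p)%N.+1; split.
  apply: (@is_L_range _ (fun p => 2 ^ m * gap_sum a3 phi2 D gap2 2 p)%N).
    move=> q; rewrite ltn_pmul2l ?expn_gt0 // gap_sumS.
    by case: (morph_inf _ _ _ _) => /=; lia.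
  by apply: occurs_iter_lift => //; exact: occurs_aa.
by rewrite !exprS pow2; have := gap_sum2E p; nia.
Qed.
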